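(* Let $S=\mathbb{C}[x_0,x_1,\ldots,x_n]$ and let $I=\langle f_1,\ldots,f_s\rangle\subset S$ be an ideal generated by homogeneous polynomials that is zero-dimensional, with $\delta<\infty$ solutions in $\mathbb{P}^n$, counting multiplicities. Let $d\in\mathbb{N}$ and let $N:S_d\to\mathbb{C}^\delta$ be a $\mathbb{C}$-linear map with $\ker(N)\subset I_d=I\cap S_d$. Assume that there is a nonzero linear form $h=h_0x_0+\cdots+h_nx_n\in S_1$ such that the map $$N_h:S_{d-1}\to\mathbb{C}^\delta,\qquad f\mapsto N(h\cdot f)$$ is surjective. Let $B\subset S_{d-1}$ be any subspace such that $S_{d-1}=B\oplus\ker(N_h)$. Then: (i) $N^*:=(N_h)_{|B}:B\to\mathbb{C}^\delta$ is invertible; (ii) there is an isomorphism of $\mathbb{C}\left[\frac{x_0}{h},\ldots,\frac{x_n}{h}\right]$-modules $h\cdot B\simeq S_d/I_d$; (iii) $S_k=h^{k-d+1}\cdot B\oplus I_k$ for all $k\ge d$, and $I=(\langle\ker(N)\rangle:h^* )$; (iv) for $i=0,\ldots,n$, the map $N_i:B\to\mathbb{C}^\delta$, $b\mapsto N(x_i\cdot b)$, decomposes as $N_i=N^*\circ m_{x_i}$, where the maps $m_{x_i}$ represent the multiplications by $x_i/h$ in $h\cdot B$ modulo $I_d$ and are commuting.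
   Context: $S_k$ is the degree $k$ homogeneous part of $S$ (with $S_k=0$ for $k<0$) and $I_k=I\cap S_k$. ''$\delta$ solutions counting multiplicities'' means that the zero-dimensional subscheme of $\mathbb{P}^n$ defined by $I$ has degree $\delta$. $\langle\ker(N)\rangle$ is the ideal of $S$ generated by $\ker(N)$. For an ideal $J\subset S$ and $p\in S$, $(J:p^* )=\{q\in S\mid \exists k\in\mathbb{N}\text{ such that }p^kq\in J\}$. In (iv), $B$ is identified with $h\cdot B$ through $b\mapsto h\cdot b$. That $m_{x_i}$ represents the multiplication by $x_i/h$ in $h\cdot B$ modulo $I_d$ means that $m_{x_i}$ maps $h\cdot b$ (with $b\in B$) to an element of $h\cdot B$ congruent to $x_i\cdot b$ modulo $I_d$; under the identification, $m_{x_i}:B\to B$ satisfies $h\cdot m_{x_i}(b)\equiv x_i\cdot b\mod I_d$. In (ii), $\frac{x_i}{h}$ acts on $S_d/I_d$ by sending the class of $h\cdot g$ ($g\in S_{d-1}$) to the class of $x_i\cdot g$, and it acts on $h\cdot B$ by sending $h\cdot b$ to the element of $h\cdot B$ congruent to $x_i\cdot b$ modulo $I_d$.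
   Formalization: In (iii), the equality I = (⟨ker(N)⟩ : h* ) fails when I is not saturated (e.g. I = ⟨x_0², x_0x_1⟩, d = 2, h = x_1); it is replaced by I^sat = (⟨ker(N)⟩ : h* ) for every I, and I = (⟨ker(N)⟩ : h* ) when I is saturated. *)

(* Defs.v *)
From HB Require Import structures.
From mathcomp Require Import all_boot all_order all_algebra.
From mathcomp Require Import boolp classical_sets functions.
From mathcomp Require Import mpoly.

Set Implicit Arguments.
Unset Strict Implicit.
Unset Printing Implicit Defensive.

Import GRing.Theory.
Local Open Scope classical_set_scope.
Local Open Scope ring_scope.

Section LinearSubsets.
Variables (K : fieldType) (V : lmodType K).

(* Linearity for the scaling s of W, of a function that is only meaningful on D;
   its values outside D are irrelevant. *)
Definition linear_on (W : zmodType) (s : K -> W -> W) (D : set V) (f : V -> W) :=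
  forall a, {in D &, {morph f : u v / a *: u + v >-> s a u + v}}.

(* The K-linear surjection p : D -> W has kernel E, i.e. p exhibits W as D / E.
   The scaling is a parameter so that W may be a module over another ring. *)
Definition quotient_map (W : zmodType) (s : K -> W -> W) (D E : set V)
    (p : V -> W) :=
  [/\ linear_on s D p, p @` D = setT & forall u, D u -> (p u = 0 <-> E u)].

Definition direct_sum (D U W : set V) :=
  D = [set u + w | u in U & w in W] /\ U `&` W = [set 0].

End LinearSubsets.

Section GradedRing.
Variables (K : fieldType) (n : nat).
Local Notation S := {mpoly K[n]}.

Definition hpart (k : int) : set S :=
  if k is Posz m then [set p | p \is m.-homog] else [set 0].

Definition ideal_gen (E : set S) : set S :=
  [set p | exists (r : nat) (c e : 'I_r -> S),
     (forall j, E (e j)) /\ p = \sum_(j < r) c j * e j].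

(* (J : p^* ) *)
Definition colon (J : set S) (p : S) : set S :=
  [set q | exists k : nat, J (p ^+ k * q)].

(* Saturation with respect to the irrelevant ideal <x_0, ..., x_n>, whose k-th
   power is generated by the forms of degree k. *)
Definition saturation (J : set S) : set S :=
  [set p | exists k : nat, forall q, hpart k q -> J (q * p)].

(* Points of the projective space are represented by nonzero coordinate
   vectors, up to scaling. *)
Definition finite_zero_locus (J : set S) :=
  exists (r : nat) (pts : 'I_r -> 'I_n -> K), forall v : 'I_n -> K,
    (exists i, v i != 0) -> (forall p, J p -> p.@[v] = 0) ->
    exists (j : 'I_r) (c : K), forall i, v i = c * pts j i.

(* The Hilbert polynomial of S / J is the constant delta: the degree of a
   zero-dimensional projective scheme is this constant. *)
Definition proj_degree (J : set S) (delta : nat) :=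
  exists k0 : nat, forall k : nat, (k0 <= k)%N ->
    exists p : S -> 'cV[K]_delta,
      quotient_map *:%R (hpart k) (J `&` hpart k) p.

End GradedRing.

(* The subring K[x_0/h, ..., x_n/h] of the fraction field of S, as the image of
   P |-> P(x_0/h, ..., x_n/h). It is meant for h != 0. *)
Section Chart.
Variables (K : fieldType) (n : nat) (h : {mpoly K[n]}).
Local Notation S := {mpoly K[n]}.

Definition chart_frac : S -> {fraction S} :=
  mmap (@FracField.tofrac S \o @mpolyC n K)
    (fun i => FracField.tofrac 'X_i / FracField.tofrac h).

Definition chart_pred : {pred {fraction S}} := mem (range chart_frac).

Fact chart_subring_closed : subring_closed chart_pred.
Proof.
split; rewrite /chart_pred.
- by apply/mem_set; exists 1 => //; rewrite /chart_frac rmorph1.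
- move=> _ _ /set_mem[p _ <-] /set_mem[q _ <-]; apply/mem_set.
  by exists (p - q) => //; rewrite /chart_frac rmorphB.
- move=> _ _ /set_mem[p _ <-] /set_mem[q _ <-]; apply/mem_set.
  by exists (p * q) => //; rewrite /chart_frac rmorphM.
Qed.

HB.instance Definition _ :=
  GRing.isSubringClosed.Build {fraction S} chart_pred chart_subring_closed.

Record chart := Chart { chart_val : {fraction S}; _ : chart_val \in chart_pred }.

HB.instance Definition _ := [isSub for chart_val].
HB.instance Definition _ := [Choice of chart by <:].
HB.instance Definition _ := [SubChoice_isSubComNzRing of chart by <:].

Fact chart_frac_in (p : S) : chart_frac p \in chart_pred.
Proof. by apply/mem_set; exists p. Qed.

Definition chart_eval (p : S) : chart := Chart (chart_frac_in p).

Definition chart_const (c : K) : chart := chart_eval c%:MP.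
Definition chart_coord (i : 'I_n) : chart := chart_eval 'X_i.

(* Scaling of a K[x_0/h, ..., x_n/h]-module by K. *)
Definition chart_scale (M : lmodType chart) (c : K) (m : M) : M :=
  chart_const c *: m.

End Chart.
Arguments chart_scale {K n h} M c m.

(* Main.v *)
From HB Require Import structures.
Require Import Defs.
From mathcomp Require Import all_boot all_order all_algebra.
From mathcomp Require Import boolp classical_sets functions reals.
From mathcomp Require Import complex mpoly.
Import GRing.Theory.
Local Open Scope classical_set_scope.
Local Open Scope ring_scope.

(** Write S' for S_{d-1}, N* for the restriction of b |-> N(h b) to B, and sigma
    for its inverse; that N* is bijective is the statement that B is a
    complement of the kernel of the surjection N_h.

    Surjectivity of N_h already gives S_d = h B + ker N, since g and
    h sigma(N g) have the same image under N. As x_i B lies in S_d, induction on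
    the degree gives S_{d+j} = h^{j+1} B + <ker N>_{d+j} (normal_form_gen).

    The hypothesis that I has degree delta enters once. For k large there is a
    surjection p from S_k onto K^delta with kernel I_k, so that
    v |-> p(h^{k-d+1} sigma v) is a linear map from K^delta to itself. It is
    onto by the previous decomposition, as ker N lies in I, and hence
    injective. If h^j b lies in I then so does every higher h^k b, and therefore
    b = 0 (normal_form_free). All the rest follows from these two facts:
    - ker N = I_d, and h can be cancelled modulo I in degrees at least d
      (kerN_ideal, linear_form_cancel);
    - the sum S_k = h^{k-d+1} B + I_k is direct, and I_k = <ker N>_k for
      k >= d, whence both inclusions between the saturation of I and
      (<ker N> : h^* ), computed one homogeneous component at a time;
    - m_i = sigma o N o x_i represents multiplication by x_i / h, and
      h^2 m_i m_j b and h^2 m_j m_i b are both congruent to x_i x_j b modulo I,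
      so m_i and m_j commute.

    For the isomorphism of modules, N identifies both h B and S_d / I_d with
    K^delta, so it suffices to let K[x_0/h, ..., x_n/h] act on K^delta. An
    element of this ring is a fraction G / h^k with G a form of degree k; it
    sends N g to N g' when G g is congruent to h^k g' modulo I. Such a g' exists
    by the decomposition of S_{d+k}, and is unique modulo ker N by cancellation
    of h (chart_module). *)

(** * Linear maps and modules *)

Lemma linear_endo_inj (K : fieldType) (V : vectType K) (phi : V -> V) :
  linear phi -> (forall w, exists v, phi v = w) ->
  forall v, phi v = 0 -> v = 0.
Proof.
move=> phiL phi_onto.
pose phiH := GRing.isLinear.Build K V V _ phi phiL.
pose psi : {linear V -> V} := HB.pack phi phiH.
have psiE v : linfun psi v = phi v by rewrite lfunE.
suff ker0 : lker (linfun psi) == 0%VS.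
  move=> v phi_v; apply/eqP; rewrite -memv0 -(eqP ker0) memv_ker psiE.
  exact/eqP.
have := limg_ker_dim (linfun psi) fullv; rewrite capfv.
suff -> : limg (linfun psi) = fullv.
  by move/eqP; rewrite -[X in _ == X]add0n eqn_add2r dimv_eq0.
apply/eqP; rewrite eqEsubv subvf; apply/subvP=> w _.
by have [v <-] := phi_onto w; rewrite -psiE memv_img ?memvf.
Qed.

(** A copy of the carrier of V, on which a module structure can be put without
    interfering with those that V may already have. *)
Definition group_of (V : zmodType) : Type := V.
HB.instance Definition _ (V : zmodType) := GRing.Zmodule.copy (group_of V) V.

(** A ring action given by its graph. Each axiom of modules becomes a closure
    property of the graph, so that representatives of ring elements never have to be
    selected uniformly. *)
Lemma module_of_relation (A : pzRingType) (V : zmodType)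
    (rho : A -> V -> V -> Prop) :
  (forall a v, exists w, rho a v w) ->
  (forall a v w w', rho a v w -> rho a v w' -> w = w') ->
  (forall v, rho 1 v v) ->
  (forall a b v w x, rho b v w -> rho a w x -> rho (a * b) v x) ->
  (forall a v v' w w', rho a v w -> rho a v' w' -> rho a (v + v') (w + w')) ->
  (forall a b v w w', rho a v w -> rho b v w' -> rho (a + b) v (w + w')) ->
  exists (M : lmodType A) (e : V -> M),
    [/\ bijective e, nmod_morphism e & forall a v w, rho a v w -> a *: e v = e w].
Proof.
move=> total func rho1 rhoM rhoDr rhoDl.
pose act a v := projT1 (cid (total a v)).
have actP a v : rho a v (act a v) by rewrite /act; case: cid.
have actE a v w : rho a v w -> act a v = w by move=> /(func _ _ _ _ (actP a v)).
have actA a b v : act a (act b v) = act (a * b) v.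
  by apply/esym/actE; apply: rhoM (actP _ _) (actP _ _).
have act1 : left_id 1 act by move=> v; apply: actE.
have actDr : right_distributive act +%R by move=> a v w; apply/actE/rhoDr.
have actDl v : {morph act^~ v : a b / a + b} by move=> a b; apply/actE/rhoDl.
pose actV := GRing.Zmodule_isLmodule.Build A (group_of V) actA act1 actDr actDl.
pose M : lmodType A := HB.pack (group_of V) actV.
by exists M, id; split => //; exists id.
Qed.

(** * Homogeneous ideals *)

Section Ideals.
Variables (K : fieldType) (n : nat).
Local Notation S := {mpoly K[n]}.

Section Generated.
Variable E : set S.
Local Notation J := (ideal_gen E).

Lemma ideal_gen_in p : E p -> J p.
Proof.
move=> Ep; exists 1%N, (fun=> 1), (fun=> p); split=> //.
by rewrite big_ord1 mul1r.
Qed.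

Lemma ideal_gen0 : J 0.
Proof.
by exists 0%N, (fun=> 0), (fun=> 0); split; [case | rewrite big_ord0].
Qed.

Lemma ideal_genD p q : J p -> J q -> J (p + q).
Proof.
move=> [r [c [e [Ee ->]]]] [r' [c' [e' [Ee' ->]]]].
exists (r + r')%N,
  (fun j => match fintype.split j with inl i => c i | inr i => c' i end),
  (fun j => match fintype.split j with inl i => e i | inr i => e' i end).
split=> [j|]; first by case: fintype.split.
rewrite big_split_ord; congr (_ + _); apply: eq_bigr => j _.
  by rewrite (unsplitK (inl j : 'I_r + 'I_r')).
by rewrite (unsplitK (inr j : 'I_r + 'I_r')).
Qed.

Lemma ideal_genMl q p : J p -> J (q * p).
Proof.
move=> [r [c [e [Ee ->]]]]; exists r, (fun j => q * c j), e; split=> //.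
by rewrite mulr_sumr; apply: eq_bigr => j _; rewrite mulrA.
Qed.

Lemma ideal_genZ a p : J p -> J (a *: p).
Proof. by rewrite -mul_mpolyC; apply: ideal_genMl. Qed.

Lemma ideal_genB p q : J p -> J q -> J (p - q).
Proof.
by move=> Jp Jq; apply: ideal_genD => //; rewrite -scaleN1r; apply: ideal_genZ.
Qed.

Lemma ideal_gen_sum (T : Type) (r : seq T) (P : pred T) (F : T -> S) :
  (forall i, P i -> J (F i)) -> J (\sum_(i <- r | P i) F i).
Proof. exact: (big_ind J ideal_gen0 ideal_genD). Qed.

Hypothesis E_homog : forall e, E e -> exists k : nat, hpart k e.

(** An ideal generated by forms contains the homogeneous components of its
    elements: if e is a form, the component of c e in some degree is either zero
    or a homogeneous component of c times e. *)
Lemma ideal_gen_pihomog p k : J p -> J (pihomog mdeg k p).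
Proof.
move=> [r [c [e [Ee ->]]]]; rewrite raddf_sum; apply: ideal_gen_sum => j _.
have [m /= e_m] := E_homog _ (Ee j).
rewrite {1}(pihomog_partitionE (leqnn (mmeasure mdeg (c j)))) mulr_suml raddf_sum.
apply: ideal_gen_sum => i _.
have ce_homog : pihomog mdeg i (c j) * e j \is (i + m).-homog.
  by apply: dhomogM => //; apply: pihomogP.
have [Ek|ne_k] := eqVneq (i + m)%N k; last first.
  by rewrite /= (pihomog_ne0 ne_k ce_homog); apply: ideal_gen0.
by rewrite /= -Ek pihomog_dE //; apply/ideal_genMl/ideal_gen_in.
Qed.

End Generated.

Lemma ideal_gen_sub (E F : set S) :
  E `<=` ideal_gen F -> ideal_gen E `<=` ideal_gen F.
Proof.
move=> EF p [r [c [e [Ee ->]]]]; apply: ideal_gen_sum => j _.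
by apply: ideal_genMl; apply: EF.
Qed.

Lemma hpart_submod (k : int) : submod_closed (mem (@hpart K n k)).
Proof.
split=> [|a p q]; rewrite !in_setE; case: k => k /=.
- exact: dhomog0.
- by [].
- by move=> hp hq; rewrite rpredD ?rpredZ.
- by move=> -> ->; rewrite scaler0 addr0.
Qed.

(** In degree d = 0 this holds because there are no forms of degree -1 but 0. *)
Lemma hpart_mul_linear (d : nat) (l p : S) :
  l \is 1.-homog -> hpart (d%:Z - 1) p -> hpart d (l * p).
Proof.
move=> l1; case: d => [/= ->|d]; first by rewrite mulr0 dhomog0.
by rewrite -addn1 PoszD addrK /= addnC => hp; apply: dhomogM.
Qed.

Lemma dhomog_linear_exp (l : S) (k : nat) :
  l \is 1.-homog -> l ^+ k \is k.-homog.
Proof. by move=> l1; have := dhomogMn k l1; rewrite mul1n. Qed.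

Lemma dhomog_linear_expM (l g : S) (k j : nat) :
  l \is 1.-homog -> g \is k.-homog -> l ^+ j * g \is (k + j).-homog.
Proof.
by move=> l1 gk; rewrite addnC; apply: dhomogM => //; apply: dhomog_linear_exp.
Qed.

(** The forms of degree k + 1 are spanned by the products of a variable and a
    form of degree k. *)
Lemma homog_step_ind (P : S -> Prop) (k : nat) :
  P 0 -> (forall a p q, P p -> P q -> P (a *: p + q)) ->
  (forall i q, q \is k.-homog -> P ('X_i * q)) ->
  forall p, p \is k.+1.-homog -> P p.
Proof.
move=> P0 PL PX p /dhomogP p_hom; rewrite (mpolyE p) big_seq.
apply: (big_rec P) => // m q m_p Pq; apply: PL => //.
have m_deg : mdeg m = k.+1 by apply: p_hom.
have [i m_i] : exists i, (0 < m i)%N.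
  apply: contrapT => m0; move: m_deg; rewrite mdegE big1 // => i _.
  by apply/eqP; rewrite -leqn0 leqNgt; apply/negP => m_i; apply: m0; exists i.
have mE : m = (U_(i) + (m - U_(i)))%MM by rewrite addmC submK // lep1mP -lt0n.
rewrite mE mpolyXD; apply: PX; rewrite dhomogX.
by apply/eqP; move: m_deg; rewrite {1}mE mdegD mdeg1 add1n; apply: succn_inj.
Qed.

Lemma pihomogMl (l q : S) (k j : nat) :
  l \is k.-homog -> pihomog mdeg (k + j) (l * q) = l * pihomog mdeg j q.
Proof.
move=> l_hom; rewrite [in LHS](mpolyE q) [in RHS](mpolyE q) mulr_sumr !raddf_sum.
rewrite mulr_sumr; apply: eq_bigr => m _ /=.
rewrite -scalerAr !linearZ /= -scalerAr pihomogX; congr (_ *: _).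
have lX_hom : l * 'X_[m] \is (k + mdeg m).-homog by rewrite dhomogM ?dhomogX.
have [<-|ne_j] := eqVneq; first by rewrite pihomog_dE.
by rewrite mulr0 (pihomog_ne0 _ lX_hom) // eqn_add2l.
Qed.

End Ideals.
Arguments ideal_genD {K n E p q}.
Arguments ideal_genB {K n E p q}.
Arguments ideal_genMl {K n E} q {p}.

(** * Functions linear on a subset *)

Section LinearOn.
Variables (K : fieldType) (V W : lmodType K) (D : set V) (p : V -> W).
Hypothesis p_lin : linear_on *:%R D p.

Lemma linear_onP a u v : D u -> D v -> p (a *: u + v) = a *: p u + p v.
Proof. by move=> Du Dv; apply: p_lin; rewrite in_setE. Qed.

Lemma linear_onB u v : D u -> D v -> p (v - u) = p v - p u.
Proof. by move=> Du Dv; rewrite addrC -scaleN1r linear_onP // scaleN1r addrC. Qed.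

Lemma linear_on0 : D 0 -> p 0 = 0.
Proof. by move=> D0; rewrite -{1}(subr0 0) linear_onB // subrr. Qed.

End LinearOn.
Arguments linear_onP {K V W D p} p_lin a {u v}.
Arguments linear_onB {K V W D p} p_lin {u v}.
Arguments linear_on0 {K V W D p} p_lin.

(** * Fractions of degree zero with denominator a power of h *)

Local Notation "x %:F" := (FracField.tofrac x).

Section ChartFractions.
Variables (K : fieldType) (n : nat) (h : {mpoly K[n]}).
Local Notation S := {mpoly K[n]}.
Hypothesis h_linear : h \is 1.-homog.
Hypothesis h_neq0 : h != 0.

(** Homogenization: an element of K[x_0/h, ..., x_n/h] is G / h^k with G a form
    of degree k. Such fractions contain the constants and the x_i / h, and are
    closed under sums and products. *)
Lemma chart_homogenize (p : S) : exists (k : nat) (g : S),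
  hpart k g /\ chart_frac h p * (h ^+ k)%:F = g%:F.
Proof.
have hF_neq0 : h%:F != 0 by rewrite tofrac_eq0.
pose Q x := exists (k : nat) (g : S), hpart k g /\ x * (h ^+ k)%:F = g%:F.
have QC (c : K) : Q (chart_frac h c%:MP).
  exists 0%N, c%:MP; rewrite /chart_frac mmapC expr0 tofrac1 mulr1; split=> //=.
  by rewrite -[c%:MP]mulr1 mul_mpolyC rpredZ // dhomog1.
have QM x y : Q x -> Q y -> Q (x * y).
  move=> [k [g [Sg xg]]] [l [g' [Sg' yg]]]; exists (k + l)%N, (g * g').
  by split; [apply: dhomogM|rewrite exprD !tofracM mulrACA xg yg].
have QD x y : Q x -> Q y -> Q (x + y).
  move=> [k [g [Sg xg]]] [l [g' [Sg' yg]]].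
  exists (k + l)%N, (h ^+ l * g + h ^+ k * g'); split.
    rewrite /= rpredD //; first exact: dhomog_linear_expM.
    by rewrite addnC; apply: dhomog_linear_expM.
  rewrite tofracD !tofracM -xg -yg exprD tofracM mulrDl (mulrCA y).
  by rewrite [x * (_ * _)]mulrA [x * _ * _]mulrC.
have QX i : Q (('X_i)%:F / h%:F).
  exists 1%N, 'X_i; rewrite expr1 divfK //.
  by split=> //=; rewrite dhomogX /= mdeg1.
have Q1 : Q 1 by have := QC 1; rewrite /chart_frac rmorph1.
have QXm m : Q (chart_frac h 'X_[m]).
  rewrite /chart_frac mmapX; apply: (big_ind Q) => // i _.
  by elim: (m i) => // e IH; rewrite exprS; apply: QM.
rewrite (mpolyE p) /chart_frac rmorph_sum; apply: (big_ind Q) => //.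
  by have := QC 0; rewrite /chart_frac rmorph0.
by move=> m _; rewrite -mul_mpolyC rmorphM; apply: QM; [apply: QC|apply: QXm].
Qed.

End ChartFractions.

(** * Normal forms modulo the ideal *)

Section NormalForms.
Variables (K : fieldType) (n : nat) (F : set {mpoly K[n]}).
Local Notation S := {mpoly K[n]}.
Variables (d delta : nat) (N : S -> 'cV[K]_delta) (h : S) (B : set S).
Local Notation I := (ideal_gen F).
Local Notation S_ := (@hpart K n).
Local Notation S' := (S_ (d%:Z - 1)).
Local Notation kerN := [set g | S_ d g /\ N g = 0].
Local Notation kerNh := [set g | S' g /\ N (h * g) = 0].
Hypothesis F_homog : forall e, F e -> exists k : nat, S_ k e.
Hypothesis I_degree : proj_degree I delta.
Hypothesis h_linear : h \is 1.-homog.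
Hypothesis h_neq0 : h != 0.
Hypothesis N_lin : linear_on *:%R (S_ d) N.
Hypothesis kerN_sub : kerN `<=` I `&` S_ d.
Hypothesis Nh_onto : [set N (h * g) | g in S'] = setT.
Hypothesis B_submod : submod_closed (mem B).
Hypothesis B_compl : direct_sum S' B kerNh.

Let S_P k a p q : S_ k p -> S_ k q -> S_ k (a *: p + q).
Proof. by have [_] := hpart_submod K n k => /(_ a p q); rewrite !in_setE. Qed.

Let S_0 k : S_ k 0.
Proof. by have [] := hpart_submod K n k; rewrite !in_setE. Qed.

Let S_B k p q : S_ k p -> S_ k q -> S_ k (p - q).
Proof. by move=> Sp Sq; rewrite addrC -scaleN1r; apply: S_P. Qed.

Let B_P a p q : B p -> B q -> B (a *: p + q).
Proof. by have [_] := B_submod => /(_ a p q); rewrite !in_setE. Qed.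

Let B_0 : B 0.
Proof. by have [] := B_submod; rewrite !in_setE. Qed.

Let kerNh_0 : kerNh 0.
Proof. by split=> //=; rewrite mulr0 (linear_on0 N_lin). Qed.

Let B_S' b : B b -> S' b.
Proof.
move=> Bb; have [-> _] := B_compl; exists b => //; exists 0; first exact: kerNh_0.
by rewrite addr0.
Qed.

Let S_hM g : S' g -> S_ d (h * g).
Proof. exact: hpart_mul_linear. Qed.

Let S_XM i g : S' g -> S_ d ('X_i * g).
Proof. by apply: hpart_mul_linear; rewrite dhomogX /= mdeg1. Qed.

Let S_hXM (k j : nat) g : S_ k g -> S_ (k + j)%N (h ^+ j * g).
Proof. exact: dhomog_linear_expM. Qed.

Let S_hXM' (j : nat) g : S' g -> S_ (d + j)%N (h ^+ j.+1 * g).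
Proof. by move=> /S_hM Sg; rewrite exprSr -mulrA; apply: S_hXM. Qed.

Lemma normal_form_bij : set_bij B setT (fun g => N (h * g)).
Proof.
have [S'E B_ker] := B_compl.
split=> // [b b'|v _].
  rewrite !in_setE => Bb Bb' Nbb'; apply/subr0_eq.
  suff: (B `&` kerNh) (b - b') by rewrite B_ker.
  have B_b : B (b - b') by rewrite addrC -scaleN1r; apply: B_P.
  split=> //; split; first exact: B_S'.
  rewrite mulrBr (linear_onB N_lin) ?Nbb' ?subrr //.
    exact/S_hM/B_S'.
  exact/S_hM/B_S'.
have: [set N (h * g) | g in S'] v by rewrite Nh_onto.
move=> [g]; rewrite S'E => -[b Bb [u [Su Nu] <-] <-]; exists b => //=.
have := linear_onP N_lin 1 (S_hM _ (B_S' _ Bb)) (S_hM _ Su).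
by rewrite !scale1r -mulrDr Nu addr0.
Qed.

Lemma normal_form_section : exists sigma : 'cV[K]_delta -> S,
  [/\ forall v, B (sigma v), forall v, N (h * sigma v) = v,
      forall b, B b -> sigma (N (h * b)) = b & linear sigma].
Proof.
have [_ inj surj] := normal_form_bij.
have ex v : exists b, B b /\ N (h * b) = v.
  by have [b Bb <-] := surj v Logic.I; exists b.
pose sigma v := projT1 (cid (ex v)).
have sB v : B (sigma v) by rewrite /sigma; case: cid => ? [].
have sK v : N (h * sigma v) = v by rewrite /sigma; case: cid => ? [].
have Ks b : B b -> sigma (N (h * b)) = b.
  by move=> Bb; apply: inj; rewrite ?in_setE.
exists sigma; split=> // a v w; have BP := B_P a _ _ (sB v) (sB w).
rewrite -[RHS]Ks // mulrDr -scalerAr (linear_onP N_lin) ?sK //.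
  exact/S_hM/B_S'.
exact/S_hM/B_S'.
Qed.

(** The element h sigma(N g) of h B has the same image as g under N. *)
Lemma normal_form_step g : S_ d g -> exists2 b, B b & kerN (g - h * b).
Proof.
move=> Sg; have [sigma [sB sK _ _]] := normal_form_section.
have Shs : S_ d (h * sigma (N g)) by exact/S_hM/B_S'.
exists (sigma (N g)) => //; split; first exact: S_B.
by rewrite (linear_onB N_lin) // sK subrr.
Qed.

(** Generation, by induction on the degree: after multiplication by x_i the
    normal form h^{j+1} b becomes h^{j+1} (x_i b), and x_i b lies in S_d where it
    is congruent to some h c modulo ker N. *)
Lemma normal_form_gen j g : S_ (d + j)%N g ->
  exists2 b, B b & ideal_gen kerN (g - h ^+ j.+1 * b).
Proof.
elim: j g => [|j IH] g.
  rewrite addn0 expr1 => /normal_form_step[b Bb kb].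
  by exists b => //; apply: ideal_gen_in.
rewrite addnS => Sg.
pose P g := exists2 b, B b & ideal_gen kerN (g - h ^+ j.+2 * b).
apply: (homog_step_ind _ _ P (d + j)%N) => // {g Sg}.
- by exists 0 => //; rewrite mulr0 subr0; apply: ideal_gen0.
- move=> a p q [b Bb Jb] [c Bc Jc]; exists (a *: b + c); first exact: B_P.
  rewrite mulrDr -scalerAr opprD addrACA -scalerBr.
  by apply: ideal_genD => //; apply: ideal_genZ.
- move=> i q /IH[b Bb Jb].
  have [c Bc kc] := normal_form_step _ (S_XM i _ (B_S' _ Bb)).
  exists c => //.
  have -> : 'X_i * q - h ^+ j.+2 * c = 'X_i * (q - h ^+ j.+1 * b)
      + h ^+ j.+1 * ('X_i * b - h * c).
    by rewrite !mulrBr addrA mulrCA subrK mulrA -exprSr.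
  by apply: ideal_genD; apply: ideal_genMl => //; apply: ideal_gen_in.
Qed.

Lemma kerN_gen_sub : ideal_gen kerN `<=` I.
Proof. by apply: ideal_gen_sub => g /kerN_sub[]. Qed.

(** Independence: a dimension count, in the form that a surjective endomorphism
    of K^delta is injective. The degree d + (k0 + j) is at once large enough for
    the Hilbert function to have reached delta and for h^j to divide the
    multiplier. *)
Lemma normal_form_free j b : B b -> I (h ^+ j * b) -> b = 0.
Proof.
move=> Bb Ihb; have [sigma [sB sK Ks sL]] := normal_form_section.
have [k0 hk0] := I_degree.
have /hk0[p [p_lin p_onto p_ker]] : (k0 <= d + (k0 + j))%N.
  by rewrite addnCA leq_addr.
pose phi v := p (h ^+ (k0 + j).+1 * sigma v).
have S_hs v : S_ (d + (k0 + j))%N (h ^+ (k0 + j).+1 * sigma v).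
  exact/S_hXM'/B_S'.
have phiL : linear phi.
  move=> a v w; rewrite /phi sL mulrDr -scalerAr.
  exact: (linear_onP p_lin).
have phi_onto w : exists v, phi v = w.
  have : (p @` S_ (d + (k0 + j))%N) w by rewrite p_onto.
  move=> [g Sg <-]; have [c Bc Jc] := normal_form_gen _ _ Sg.
  exists (N (h * c)); apply/subr0_eq; rewrite -opprB; apply/eqP.
  rewrite oppr_eq0 -(linear_onB p_lin) //; apply/eqP.
  apply/p_ker; first exact: S_B.
  rewrite Ks //; split; [exact: kerN_gen_sub | apply: S_B => //].
  exact/S_hXM'/B_S'.
suff Nb0 : N (h * b) = 0.
  by rewrite -(Ks _ Bb) Nb0 -[in RHS](Ks _ B_0) mulr0 (linear_on0 N_lin).
apply: (linear_endo_inj _ _ _ phiL phi_onto).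
apply/p_ker; first exact: S_hs.
split; last exact: S_hs.
by rewrite Ks // -addSn exprD -mulrA; apply: ideal_genMl.
Qed.

(** The component of g along h B lies in I with g, hence vanishes by
    independence. With the hypothesis on ker N this makes ker N equal to I_d. *)
Lemma kerN_ideal g : S_ d g -> I g -> N g = 0.
Proof.
move=> Sg Ig; have [b Bb kb] := normal_form_step _ Sg.
have b0 : b = 0.
  apply: (normal_form_free 1) => //; rewrite expr1 -(subKr g (h * b)).
  by apply: ideal_genB => //; case: (kerN_sub _ kb).
by case: kb; rewrite b0 mulr0 subr0.
Qed.

(** Cancellation of h in degrees at least d. The conclusion is membership in
    the smaller ideal <ker N>; for l = 0 the lemma says that I and <ker N>
    coincide in these degrees. *)
Lemma linear_form_cancel j l g :
  S_ (d + j)%N g -> I (h ^+ l * g) -> ideal_gen kerN g.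
Proof.
move=> Sg Ihg; have [b Bb Jb] := normal_form_gen _ _ Sg.
suff b0 : b = 0 by move: Jb; rewrite b0 mulr0 subr0.
apply: (normal_form_free (l + j.+1)) => //.
rewrite exprD -mulrA -(subKr (h ^+ l * g) (_ * _)) -mulrBr.
by apply: ideal_genB => //; apply/ideal_genMl/kerN_gen_sub.
Qed.

Lemma normal_form_direct_sum (k : nat) : (d <= k)%N ->
  direct_sum (S_ k) [set h ^+ (k - d + 1) * b | b in B] (I `&` S_ k).
Proof.
move=> /subnKC <-; rewrite addKn addn1; set j := (k - d)%N.
split; apply/seteqP; split.
- move=> g Sg; have [b Bb Jb] := normal_form_gen _ _ Sg.
  exists (h ^+ j.+1 * b); first by exists b.
  exists (g - h ^+ j.+1 * b); last by rewrite addrC subrK.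
  split; first exact: kerN_gen_sub.
  by apply: S_B => //; apply/S_hXM'/B_S'.
- move=> _ [_ [b Bb <-]] [w [_ Sw] <-].
  by rewrite -(scale1r (_ * b)); apply: S_P => //; apply/S_hXM'/B_S'.
- by move=> _ [[b Bb <-] [/normal_form_free-> // _]]; rewrite mulr0.
- move=> _ ->; split; first by exists 0 => //; rewrite mulr0.
  by split; [apply: ideal_gen0|apply: S_0].
Qed.

(** Both inclusions are proved on the homogeneous components q_j of q, where
    linear_form_cancel applies once the degree has been raised to at least d:
    by an extra factor h^d in one direction, by a form p of degree d in the
    other. *)
Lemma saturation_colon : saturation I = colon (ideal_gen kerN) h.
Proof.
have partE (q : S) := pihomog_partitionE (leqnn (mmeasure mdeg q)).
apply/seteqP; split=> q [k].
  have h_k : S_ k (h ^+ k) by apply: dhomog_linear_exp.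
  move=> /(_ _ h_k) I_hq; exists (d + k)%N; rewrite (partE q) mulr_sumr.
  apply: ideal_gen_sum => j _; apply: (linear_form_cancel (k + j) 0).
    rewrite addnA; apply: dhomogM; last exact: pihomogP.
    exact: dhomog_linear_exp.
  rewrite expr0 mul1r exprD -mulrA; apply: ideal_genMl.
  by rewrite -(pihomogMl _ _ _ _ k) //; apply: ideal_gen_pihomog.
move=> J_hq; exists d => p Sp; rewrite (partE q) mulr_sumr.
apply: ideal_gen_sum => j _; apply/kerN_gen_sub/(linear_form_cancel j k).
  by apply: dhomogM => //; apply: pihomogP.
rewrite mulrCA; apply: ideal_genMl; rewrite -(pihomogMl _ _ _ _ k).
  exact/ideal_gen_pihomog/kerN_gen_sub.
exact: dhomog_linear_exp.
Qed.

(** With m_i = sigma o N o x_i, the elements m_i (m_j b) and m_j (m_i b) of B are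
    equal because their multiples by h^2 are congruent modulo I. *)
Lemma multiplication_maps : exists m : 'I_n -> S -> S,
  [/\ forall i b, B b -> B (m i b),
      forall i, linear_on *:%R B (m i),
      forall i b, B b -> N ('X_i * b) = N (h * m i b),
      forall i b, B b -> (I `&` S_ d) (h * m i b - 'X_i * b)
    & forall i j b, B b -> m i (m j b) = m j (m i b)].
Proof.
have [sigma [sB sK Ks sL]] := normal_form_section.
pose m i b := sigma (N ('X_i * b)).
have mB i b : B (m i b) by apply: sB.
have mI i b : B b -> (I `&` S_ d) (h * m i b - 'X_i * b).
  move=> Bb; apply: kerN_sub; have SXb := S_XM i _ (B_S' _ Bb).
  have Shm := S_hM _ (B_S' _ (mB i b)).
  by split; [apply: S_B|rewrite (linear_onB N_lin) // sK subrr].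
exists m; split=> // [i a b c|i b Bb|i j b Bb].
- rewrite !in_setE => Bb Bc; rewrite /m mulrDr -scalerAr.
  by rewrite (linear_onP N_lin) ?sL //; apply: S_XM; apply: B_S'.
- by rewrite sK.
- apply/subr0_eq/(normal_form_free 2).
    by rewrite addrC -scaleN1r; apply: B_P.
  have I1 i' j' : I (h ^+ 2 * m i' (m j' b) - 'X_i' * ('X_j' * b)).
    have -> : h ^+ 2 * m i' (m j' b) - 'X_i' * ('X_j' * b) =
      h * (h * m i' (m j' b) - 'X_i' * m j' b) + 'X_i' * (h * m j' b - 'X_j' * b).
      by rewrite !mulrBr addrA (mulrCA 'X_i' h) subrK expr2 -mulrA.
    apply: ideal_genD; apply: ideal_genMl; first by case: (mI i' _ (mB j' b)).
    by case: (mI j' _ Bb).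
  have := ideal_genB (I1 i j) (I1 j i).
  by rewrite (mulrCA 'X_i) opprB addrA subrK mulrBr.
Qed.

(** The common model K^delta of h B and S_d / I_d: G / h^k sends N g to N g' when
    G g = h^k g' modulo I. Two representations of the same fraction and the same
    vector give the same result since h can be cancelled modulo I. *)
Lemma chart_module : exists (M : lmodType (chart h)) (e : 'cV[K]_delta -> M),
  [/\ bijective e, nmod_morphism e,
      forall c v, chart_const h c *: e v = e (c *: v)
    & forall i g, S' g -> chart_coord h i *: e (N (h * g)) = e (N ('X_i * g))].
Proof.
have [sigma [sB sK Ks sL]] := normal_form_section.
pose sigmaH := GRing.isLinear.Build K _ _ _ sigma sL.
pose sigmaL : {linear 'cV[K]_delta -> S} := HB.pack sigma sigmaH.
(* tau v is the preimage of v under N that lies in h B. *)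
pose tau v := h * sigmaL v.
have tauD v w : tau (v + w) = tau v + tau w by rewrite /tau linearD mulrDr.
have tauZ c v : tau (c *: v) = c%:MP * tau v.
  by rewrite /tau linearZ /= mul_mpolyC scalerAr.
have tau_S v : S_ d (tau v) by apply/S_hM/B_S'/sB.
have tau_N g : S_ d g -> I (tau (N g) - g).
  move=> Sg; have := tau_S (N g) => St; apply: proj1 (kerN_sub _ _).
  by split; [apply: S_B|rewrite (linear_onB N_lin) // sK subrr].
have tau_free k v w : I (h ^+ k * (tau v - tau w)) -> v = w.
  rewrite /tau -mulrBr -linearB mulrA -exprSr => /normal_form_free s0.
  have {}s0 : sigma (v - w) = 0 by apply: s0.
  by apply/subr0_eq; rewrite -(sK (v - w)) s0 mulr0 (linear_on0 N_lin).
pose rho (a : chart h) v w := exists (k : nat) (G : S),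
  [/\ S_ k G, chart_val a * (h ^+ k)%:F = G%:F
    & I (h ^+ k * tau w - G * tau v)].
have cross (x : {fraction S}) k l G G' :
    x * (h ^+ k)%:F = G%:F -> x * (h ^+ l)%:F = G'%:F -> h ^+ l * G = h ^+ k * G'.
  move=> xG xG'; apply/eqP; rewrite -tofrac_eq !tofracM -xG -xG'.
  by rewrite mulrCA [X in _ == X]mulrCA [_%:F * _%:F]mulrC.
have total a v : exists w, rho a v w.
  case: a => x x_in; have /set_mem[p _ px] := x_in.
  have [k [G [SG]]] := chart_homogenize _ _ _ h_linear h_neq0 p;
    rewrite {}px => xG.
  have SGt : S_ (d + k)%N (G * tau v).
    by rewrite addnC; apply: dhomogM => //; apply: tau_S.
  have [b Bb Jb] := normal_form_gen _ _ SGt.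
  exists (N (h * b)), k, G; split=> //; rewrite /tau /= Ks // mulrA -exprSr.
  by rewrite -opprB -scaleN1r; apply/ideal_genZ/kerN_gen_sub.
have func a v w w' : rho a v w -> rho a v w' -> w = w'.
  move=> [k [G [_ aG Iw]]] [l [G' [_ aG' Iw']]]; apply: (tau_free (k + l)%N).
  have := ideal_genB (ideal_genMl (h ^+ l) Iw) (ideal_genMl (h ^+ k) Iw').
  congr (I _); rewrite !mulrBr (mulrA _ G) (mulrA _ G') (cross _ _ _ _ _ aG aG').
  by rewrite opprB addrA subrK !mulrA -!exprD addnC.
have val1 : chart_val (1 : chart h) = 1 := rmorph1 (val : chart h -> _).
have valD (a b : chart h) : chart_val (a + b) = chart_val a + chart_val b.
  exact: (rmorphD (val : chart h -> _)).
have valM (a b : chart h) : chart_val (a * b) = chart_val a * chart_val b.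
  exact: (rmorphM (val : chart h -> _)).
have rho1 v : rho 1 v v.
  exists 0%N, 1; rewrite expr0 tofrac1 mulr1 mul1r subrr val1.
  by split; [apply: dhomog1| |apply: ideal_gen0].
have rhoM a b v w x : rho b v w -> rho a w x -> rho (a * b) v x.
  move=> [k [G [SG bG Iw]]] [l [G' [SG' aG Ix]]]; exists (l + k)%N, (G' * G).
  split; first exact: dhomogM.
    by rewrite exprD !tofracM valM mulrACA aG bG.
  have := ideal_genD (ideal_genMl (h ^+ k) Ix) (ideal_genMl G' Iw).
  congr (I _); rewrite !mulrBr (mulrCA G' (h ^+ k)) addrA subrK.
  by rewrite !mulrA -exprD addnC.
have rhoDl a b v w w' : rho a v w -> rho b v w' -> rho (a + b) v (w + w').
  move=> [k [G [SG aG Iw]]] [l [G' [SG' bG Iw']]].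
  exists (k + l)%N, (h ^+ l * G + h ^+ k * G'); split.
  - by rewrite /= rpredD //; [apply: S_hXM|rewrite addnC; apply: S_hXM].
  - rewrite valD exprD tofracD !tofracM -aG -bG mulrDl (mulrCA (chart_val b)).
    by rewrite [chart_val a * (_ * _)]mulrA [chart_val a * _ * _]mulrC.
  - have := ideal_genD (ideal_genMl (h ^+ l) Iw) (ideal_genMl (h ^+ k) Iw').
    congr (I _); rewrite tauD !mulrBr addrACA -opprD mulrDr mulrDl !mulrA -!exprD.
    by rewrite [(l + k)%N]addnC.
have rhoDr a v v' w w' : rho a v w -> rho a v' w' -> rho a (v + v') (w + w').
  move=> [k [G [SG aG Iw]]] [l [G' [SG' aG' Iw']]].
  (* Both hypotheses are brought to the representation h^l G / h^(k + l) of a,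
     whose numerator is also h^k G'. *)
  exists (k + l)%N, (h ^+ l * G); split; first exact: S_hXM.
    by rewrite exprD !tofracM -aG mulrA mulrC.
  have := ideal_genD (ideal_genMl (h ^+ l) Iw) (ideal_genMl (h ^+ k) Iw').
  congr (I _); rewrite !tauD !mulrBr addrACA -opprD !mulrDr !mulrA -!exprD.
  by rewrite [(l + k)%N]addnC (cross _ _ _ _ _ aG aG').
have [M [e [e_bij e_morph eE]]] :=
  module_of_relation (chart h) 'cV[K]_delta rho total func rho1 rhoM rhoDr rhoDl.
exists M, e; split=> // [c v|i g Sg]; apply: eE.
  exists 0%N, c%:MP; split.
  - by rewrite /= -[c%:MP]mulr1 mul_mpolyC rpredZ // dhomog1.
  - by rewrite /= /chart_frac mmapC expr0 tofrac1 mulr1.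
  - by rewrite expr0 mul1r tauZ subrr; apply: ideal_gen0.
exists 1%N, 'X_i; split.
- by rewrite /= dhomogX /= mdeg1.
- by rewrite /= /chart_frac mmapX mmap1U expr1 divfK // tofrac_eq0.
- have := ideal_genB (ideal_genMl h (tau_N _ (S_XM i _ Sg)))
    (ideal_genMl 'X_i (tau_N _ (S_hM _ Sg))).
  by congr (I _); rewrite expr1 !mulrBr (mulrCA 'X_i h g) opprB addrA subrK.
Qed.

(** Both modules are K^delta with the action of the previous lemma, and both
    quotient maps are N: it is injective on h B, and its kernel on S_d is I_d. *)
Lemma chart_isomorphism :
  exists (M Q : lmodType (chart h)) (u : S -> M) (v : S -> Q),
  [/\ quotient_map (chart_scale M) [set h ^+ 1 * b | b in B] [set 0] u,
      quotient_map (chart_scale Q) (S_ d) (I `&` S_ d) v,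
      forall i b, B b -> exists b',
        [/\ B b', (I `&` S_ d) (h * b' - 'X_i * b)
          & chart_coord h i *: u (h * b) = u (h * b')],
      forall i g, S' g -> chart_coord h i *: v (h * g) = v ('X_i * g)
    & exists phi : {linear M -> Q}, bijective phi].
Proof.
have [M [e [e_bij [e0 eD] eZ eX]]] := chart_module.
have [m [mB _ mN mI _]] := multiplication_maps.
have [_ Nh_inj Nh_surj] := normal_form_bij.
have eN_lin D : D `<=` S_ d -> linear_on (chart_scale M) D (e \o N).
  move=> D_sub a p q; rewrite !in_setE => /D_sub Sp /D_sub Sq.
  by rewrite /= (linear_onP N_lin) // eD /chart_scale eZ.
have e_eq0 w : e w = 0 <-> w = 0.
  by rewrite -[X in _ = X <-> _]e0; split=> [/(bij_inj e_bij)|->].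
have [e' _ e'K] := e_bij.
exists M, M, (e \o N), (e \o N); split.
- split.
  + by apply: eN_lin => _ [b /B_S'/S_hM Sb <-].
  + apply/seteqP; split=> // w _; have [b Bb Nb] := Nh_surj (e' w) Logic.I.
    by exists (h * b); [exists b; rewrite ?expr1|rewrite /= Nb e'K].
  + move=> _ [b Bb <-]; rewrite expr1 /= e_eq0; split=> [Nb|->].
      have -> : b = 0.
        apply: Nh_inj; rewrite ?in_setE // Nb mulr0.
        by rewrite (linear_on0 N_lin).
      by rewrite mulr0.
    exact: (linear_on0 N_lin).
- split; first exact: eN_lin.
    apply/seteqP; split=> // w _; have [b Bb Nb] := Nh_surj (e' w) Logic.I.
    by exists (h * b); [apply/S_hM/B_S'|rewrite /= Nb e'K].
  move=> g Sg; rewrite /= e_eq0; split=> [Ng|[Ig _]]; first exact: kerN_sub.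
  exact: kerN_ideal.
- move=> i b Bb; exists (m i b); split; [exact: mB|exact: mI|].
  by rewrite /= eX ?mN //; apply: B_S'.
- by move=> i g Sg /=; rewrite eX.
- by exists (idfun : {linear M -> M}); exists idfun.
Qed.

End NormalForms.

Theorem theorem5p1 (R : realType) (n : nat)
    (s : nat) (f : 'I_s -> {mpoly R[i][n.+1]}) (delta d : nat)
    (N : {mpoly R[i][n.+1]} -> 'cV[R[i]]_delta)
    (hc : 'I_n.+1 -> R[i]) (B : set {mpoly R[i][n.+1]}) :
  let S_ := @hpart R[i] n.+1 in
  let I := ideal_gen (range f) in
  let I_ k := I `&` S_ k in
  let h := \sum_(i < n.+1) hc i *: 'X_i in
  let Nh g := N (h * g) in
  let kerN := [set g | S_ d g /\ N g = 0] in
  let kerNh := [set g | S_ (d%:Z - 1) g /\ Nh g = 0] in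
  let hB k := [set h ^+ k * b | b in B] in
  (forall j, exists e : nat, S_ e (f j)) ->
  finite_zero_locus I ->
  proj_degree I delta ->
  linear_on *:%R (S_ d) N ->
  kerN `<=` I_ d ->
  h != 0 ->
  Nh @` S_ (d%:Z - 1) = setT ->
  submod_closed (mem B) ->
  direct_sum (S_ (d%:Z - 1)) B kerNh ->
  [/\ (* (i) *)
      set_bij B setT Nh,
      (* (ii) *)
      exists (M Q : lmodType (chart h))
             (u : {mpoly R[i][n.+1]} -> M) (v : {mpoly R[i][n.+1]} -> Q),
        [/\ quotient_map (chart_scale M) (hB 1%N) [set 0] u,
            quotient_map (chart_scale Q) (S_ d) (I_ d) v,
            forall i b, B b -> exists b',
              [/\ B b', I_ d (h * b' - 'X_i * b)
                & chart_coord h i *: u (h * b) = u (h * b')],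
            forall i g, S_ (d%:Z - 1) g ->
              chart_coord h i *: v (h * g) = v ('X_i * g)
          & exists phi : {linear M -> Q}, bijective phi],
      (* (iii) *)
      [/\ forall k : nat, (d <= k)%N ->
            direct_sum (S_ k) (hB (k - d + 1)%N) (I_ k),
          saturation I = colon (ideal_gen kerN) h
        & saturation I = I -> I = colon (ideal_gen kerN) h]
    & (* (iv) *)
      exists m : 'I_n.+1 -> {mpoly R[i][n.+1]} -> {mpoly R[i][n.+1]},
        [/\ forall i b, B b -> B (m i b),
            forall i, linear_on *:%R B (m i),
            forall i b, B b -> N ('X_i * b) = Nh (m i b),
            forall i b, B b -> I_ d (h * m i b - 'X_i * b)
          & forall i j b, B b -> m i (m j b) = m j (m i b)]].
Proof.
move=> S_ I I_ h Nh kerN kerNh hB f_homog _ I_degree N_lin kerN_sub h_neq0 Nh_onto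
  B_submod B_compl.
have F_homog e : range f e -> exists k : nat, S_ k e by move=> [j _ <-].
have h_linear : h \is 1.-homog.
  by apply: rpred_sum => i _; apply: rpredZ; rewrite dhomogX /= mdeg1.
have sat := saturation_colon _ _ _ _ _ _ _ _ F_homog I_degree h_linear N_lin
  kerN_sub Nh_onto B_submod B_compl.
split.
- exact: normal_form_bij h_linear N_lin Nh_onto B_submod B_compl.
- exact: chart_isomorphism I_degree h_linear h_neq0 N_lin kerN_sub Nh_onto
    B_submod B_compl.
- split=> [||<-] //.
  exact: normal_form_direct_sum I_degree h_linear N_lin kerN_sub Nh_onto
    B_submod B_compl.
- exact: multiplication_maps I_degree h_linear N_lin kerN_sub Nh_onto
    B_submod B_compl.
Qed.
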